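(* (The second double fundamental theorem of calculus) Let $a,b\in\mathbb{R}^2$ with $a<b$ and let $f$ be a double function defined on $[a,b]$. Suppose that there exists a double primitive function $F$ of $f$ on $[a,b]$. If $f$ is Riemann integrable on $[a,b]$, then $$\iint_{[a,b]} f(x)\,dx_1\,dx_2=\int_a^b f ,$$ where the right-hand side is the double Newton integral of $f$ from $a$ to $b$.
   Context: Points of $\mathbb{R}^2$ are written $a=(a_1,a_2)$. $a<b$ means $a_1<b_1$ and $a_2<b_2$; $a\le b$ means $a_1\le b_1$ and $a_2\le b_2$; $a\nsim b$ means $a_1\ne b_1$ and $a_2\ne b_2$. $[a,b]=\{x\in\mathbb{R}^2:a\le x\le b\}$. A double function is a real-valued function $g$ with domain $D(g)\subseteq\mathbb{R}^2$. The double difference is $\Delta_p^x(g)=g(x_1,x_2)-g(x_1,p_2)-g(p_1,x_2)+g(p_1,p_2)$, and for $p\nsim x$, $m_p^x(g)=\Delta_p^x(g)/((x_1-p_1)(x_2-p_2))$. $g$ is double differentiable at $p$ with double derivative $g'(p)\in\mathbb{R}$ if $D(g)$ contains a product of two open intervals containing $p$ and for every $\epsilon>0$ there are $\delta_1,\delta_2>0$ such that for all $x$ with $0<|x_1-p_1|<\delta_1$, $0<|x_2-p_2|<\delta_2$, $m_p^x(g)$ is defined and $|m_p^x(g)-g'(p)|<\epsilon$. For signs $\sigma,\tau\in\{+,-\}$, the $\sigma\tau$-double derivative $g'_{\sigma\tau}(p)$ is defined in the same way, but restricting to those $x$ for which $x_1-p_1$ has sign $\sigma$ and $x_2-p_2$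 has sign $\tau$ (the domain being required to contain $p$ and all points $x$ with $|x_i-p_i|<\delta_i$, $i=1,2$, in the corresponding closed quadrant with vertex $p$, for some $\delta_1,\delta_2>0$). $F:[a,b]\to\mathbb{R}$ is a double primitive function of $f$ on $[a,b]$ if $F'(p)=f(p)$ at each interior point $p$ of $[a,b]$ and, at each boundary point $p$, $F'_{\sigma\tau}(p)$ exists and equals $f(p)$ for every sign pair $\sigma\tau$ for which the corresponding closed quadrant with vertex $p$, intersected with some open rectangle centred at $p$, is contained in $[a,b]$. The double Newton integral is $\int_a^b f:=\Delta_a^b(F)$, which does not depend on the choice of $F$. $f$ is Riemann integrable over $[a,b]$ with integral $I=\iint_{[a,b]}f(x)\,dx_1dx_2$ if for every $\epsilon>0$ there is $\delta>0$ such that for all partitions $a_1=x_{1,0}<\dots<x_{1,m}=b_1$, $a_2=x_{2,0}<\dots<x_{2,n}=b_2$ in which all rectangles $R_{ij}=[x_{1,i-1},x_{1,i}]\times[x_{2,j-1},x_{2,j}]$ have diagonal $<\delta$, and all choices of points $x^*_{ij}\in R_{ij}$, one has $|\sum_{i,j}f(x^*_{ij})(x_{1,i}-x_{1,i-1})(x_{2,j}-x_{2,j-1})-I|<\epsilon$. *)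

(* Defs.v *)
From mathcomp Require Import all_boot all_order all_algebra.
From mathcomp Require Import all_classical all_reals all_analysis.
Import Order.TTheory GRing.Theory Num.Theory.
Import numFieldNormedType.Exports.

Set Implicit Arguments.
Unset Strict Implicit.
Unset Printing Implicit Defensive.

Local Open Scope classical_set_scope.
Local Open Scope ring_scope.

Section DoubleFunctions.
Context {R : realType}.
Implicit Types (a b p x : R * R).

Definition pt_lt a b : Prop := a.1 < b.1 /\ a.2 < b.2.
Definition pt_le a b : Prop := a.1 <= b.1 /\ a.2 <= b.2.
Definition rect a b : set (R * R) := [set x | pt_le a x /\ pt_le x b].

(* A partial function on the plane.  The values of [dval] outside [ddom] are
   junk: every definition below requires the points where it evaluates [dval]
   to lie in [ddom]. *)
Record double_function := DoubleFunction {
  ddom : set (R * R);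
  dval :> R * R -> R }.
Implicit Types (f g F : double_function).

Definition ddiff p x g : R :=
  g (x.1, x.2) - g (x.1, p.2) - g (p.1, x.2) + g (p.1, p.2).

Definition ddiff_defined p x g : Prop :=
  [/\ ddom g (x.1, x.2), ddom g (x.1, p.2), ddom g (p.1, x.2)
    & ddom g (p.1, p.2)].

(* Meaningful when [x.1 != p.1] and [x.2 != p.2]. *)
Definition dslope p x g : R := ddiff p x g / ((x.1 - p.1) * (x.2 - p.2)).

Definition is_dderiv g p (l : R) : Prop :=
  (exists u v, [/\ pt_lt u p, pt_lt p v
     & forall x, pt_lt u x -> pt_lt x v -> ddom g x]) /\
  (forall e : R, 0 < e -> exists d1 d2 : R, [/\ 0 < d1, 0 < d2
     & forall x, 0 < `|x.1 - p.1| < d1 -> 0 < `|x.2 - p.2| < d2 ->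
         ddiff_defined p x g /\ `|dslope p x g - l| < e]).

Variant sign := Plus | Minus.

Definition has_sign (s : sign) (t : R) : Prop :=
  match s with Plus => 0 < t | Minus => t < 0 end.

Definition has_weak_sign (s : sign) (t : R) : Prop :=
  match s with Plus => 0 <= t | Minus => t <= 0 end.

Definition closed_quadrant (s t : sign) p : set (R * R) :=
  [set x | has_weak_sign s (x.1 - p.1) /\ has_weak_sign t (x.2 - p.2)].

Definition contains_quadrant_near (s t : sign) p (D : set (R * R)) : Prop :=
  exists d1 d2 : R, [/\ 0 < d1, 0 < d2
    & forall x, closed_quadrant s t p x ->
        `|x.1 - p.1| < d1 -> `|x.2 - p.2| < d2 -> D x].

Definition is_dderiv_sided (s t : sign) g p (l : R) : Prop :=
  contains_quadrant_near s t p (ddom g) /\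
  (forall e : R, 0 < e -> exists d1 d2 : R, [/\ 0 < d1, 0 < d2
     & forall x, 0 < `|x.1 - p.1| < d1 -> 0 < `|x.2 - p.2| < d2 ->
         has_sign s (x.1 - p.1) -> has_sign t (x.2 - p.2) ->
         ddiff_defined p x g /\ `|dslope p x g - l| < e]).

Definition double_primitive a b f F : Prop :=
  [/\ ddom F = rect a b,
      forall p, interior (rect a b) p -> is_dderiv F p (f p)
    & forall p, rect a b p -> ~ interior (rect a b) p ->
        forall s t, contains_quadrant_near s t p (rect a b) ->
          is_dderiv_sided s t F p (f p)].

(* The value is the double difference of any double primitive; that it does
   not depend on the primitive is part of the predicate. *)
Definition is_double_Newton_integral a b f (I : R) : Prop :=
  (exists F, double_primitive a b f F) /\
  (forall F, double_primitive a b f F -> ddiff a b F = I).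

(* [itv_partition c d s] lists the division points of [c, d] other than [c]
   in [s]: the i-th division point is [nth d (c :: s) i], for
   [0 <= i <= size s]. *)
Definition part_pt (c d : R) (s : seq R) (i : nat) : R := nth d (c :: s) i.

Definition part_len (c d : R) (s : seq R) (i : nat) : R :=
  part_pt c d s i.+1 - part_pt c d s i.

Definition part_cell a b (s1 s2 : seq R) (i j : nat) : set (R * R) :=
  rect (part_pt a.1 b.1 s1 i, part_pt a.2 b.2 s2 j)
       (part_pt a.1 b.1 s1 i.+1, part_pt a.2 b.2 s2 j.+1).

Definition part_diag a b (s1 s2 : seq R) (i j : nat) : R :=
  Num.sqrt (part_len a.1 b.1 s1 i ^+ 2 + part_len a.2 b.2 s2 j ^+ 2).

Definition Riemann_sum a b (s1 s2 : seq R) (xi : nat -> nat -> R * R) f : R :=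
  \sum_(i < size s1) \sum_(j < size s2)
     f (xi i j) * part_len a.1 b.1 s1 i * part_len a.2 b.2 s2 j.

Definition is_double_Riemann_integral a b f (I : R) : Prop :=
  forall e : R, 0 < e -> exists2 d : R, 0 < d &
    forall (s1 s2 : seq R) (xi : nat -> nat -> R * R),
      itv_partition a.1 b.1 s1 -> itv_partition a.2 b.2 s2 ->
      (forall i j, (i < size s1)%N -> (j < size s2)%N ->
         part_diag a b s1 s2 i j < d) ->
      (forall i j, (i < size s1)%N -> (j < size s2)%N ->
         part_cell a b s1 s2 i j (xi i j)) ->
      `|Riemann_sum a b s1 s2 xi f - I| < e.

End DoubleFunctions.

Arguments double_function R : clear implicits.

(* Main.v *)
(** On a small rectangle [[u, v]] containing [p], splitting into the four
   quadrants at [p] shows that the double difference of a primitive [F] is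
   [f p] times the area, up to [e] times the area.  Repeatedly quartering a
   rectangle, always keeping a quarter on which the mean slope of [F] is at
   least the original one, therefore yields a point where [f] is at least the
   mean slope of [F]; the same applied to [-F] gives a point where [f] is at
   most that slope.  With these points as tags, the Riemann sums of a fine
   partition bracket the double difference of [F], by additivity, and they are
   all close to the Riemann integral. *)
Require Import Defs.
From mathcomp Require Import all_boot all_order all_algebra.
From mathcomp Require Import all_classical all_reals all_analysis.
From mathcomp Require Import ring lra.
Import Order.TTheory GRing.Theory Num.Theory.
Import numFieldNormedType.Exports.

Set Implicit Arguments.
Unset Strict Implicit.
Unset Printing Implicit Defensive.

Local Open Scope classical_set_scope.
Local Open Scope ring_scope.

Section SecondFundamentalTheorem.
Context {R : realType}.
Implicit Types (a b p u v x : R * R) (F G f : double_function R).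

(** * Double derivatives relative to a closed rectangle *)

Definition area u v : R := (v.1 - u.1) * (v.2 - u.2).

(* At a boundary point, this constrains only the quadrants that meet the
   rectangle. *)
Definition dderiv_within a b F (h : R * R -> R) : Prop :=
  forall p, rect a b p -> forall e : R, 0 < e -> exists2 d : R, 0 < d &
    forall x, rect a b x -> `|x.1 - p.1| < d -> `|x.2 - p.2| < d ->
      `|ddiff p x F - h p * area p x| <= e * `|area p x|.

Lemma has_sign_neq0 s (t : R) : has_sign s t -> t != 0.
Proof. by case: s => /= ?; [rewrite gt_eqF|rewrite lt_eqF]. Qed.

(** Near [p], the points of the quadrant lie coordinatewise between [p] and [x], hence in the
    rectangle. So a single point of the rectangle strictly inside a quadrant forces the definition
    of a primitive to prescribe that sided derivative. *)
Lemma quadrant_near_rect a b p x s t :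
  rect a b p -> rect a b x -> has_sign s (x.1 - p.1) -> has_sign t (x.2 - p.2) ->
  contains_quadrant_near s t p (rect a b).
Proof.
move=> [[ap1 ap2] [pb1 pb2]] [[ax1 ax2] [xb1 xb2]] sx tx.
exists `|x.1 - p.1|, `|x.2 - p.2|; split.
- by rewrite normr_gt0 (has_sign_neq0 sx).
- by rewrite normr_gt0 (has_sign_neq0 tx).
move=> y [sy ty]; rewrite !ltr_norml => /andP[h1 h2] /andP[h3 h4].
have [y1a y1b] : a.1 <= y.1 /\ y.1 <= b.1.
  case: s sx sy => /= sx sy; move: h1 h2.
    by rewrite gtr0_norm // => *; split; lra.
  by rewrite ltr0_norm // => *; split; lra.
have [y2a y2b] : a.2 <= y.2 /\ y.2 <= b.2.
  case: t tx ty => /= tx ty; move: h3 h4.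
    by rewrite gtr0_norm // => *; split; lra.
  by rewrite ltr0_norm // => *; split; lra.
by split; split.
Qed.

Lemma is_dderiv_sidedW s t F p l :
  contains_quadrant_near s t p (ddom F) ->
  is_dderiv F p l -> is_dderiv_sided s t F p l.
Proof.
move=> qF [_ dF]; split=> // e /dF [d1 [d2 [d10 d20 h]]].
by exists d1, d2; split=> // x ? ? _ _; exact: h.
Qed.

(** If the rectangle does not contain the quadrant near [p], no [x] qualifies and any radius works.
    Otherwise the sided derivative is [f p], at interior points by restricting the full limit, and
    the bound is its estimate multiplied by the area. *)
Lemma dderiv_within_quadrant a b f F p (s t : sign) (e : R) :
  double_primitive a b f F -> rect a b p -> 0 < e ->
  exists2 d : R, 0 < d &
    forall x, rect a b x -> has_sign s (x.1 - p.1) -> has_sign t (x.2 - p.2) ->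
      `|x.1 - p.1| < d -> `|x.2 - p.2| < d ->
      `|ddiff p x F - f p * area p x| <= e * `|area p x|.
Proof.
move=> [domF intF bdF] abp e0.
have [qp|nqp] := pselect (contains_quadrant_near s t p (rect a b)); last first.
  by exists 1 => // x abx sx tx; case: nqp; exact: quadrant_near_rect sx tx.
have [_ /(_ _ e0) [d1 [d2 [d10 d20 dF]]]] : is_dderiv_sided s t F p (f p).
  have [ip|nip] := pselect (interior (rect a b) p); last exact: bdF.
  by apply: is_dderiv_sidedW (intF _ ip); rewrite domF.
exists (Num.min d1 d2) => [|x abx sx tx]; first by rewrite lt_min d10.
rewrite !lt_min => /andP[xd1 _] /andP[_ xd2].
have x1 := has_sign_neq0 sx.
have x2 := has_sign_neq0 tx.
have [||_ ltF] := dF x _ _ sx tx; rewrite ?normr_gt0 ?x1 ?x2 //.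
have -> : ddiff p x F - f p * area p x = (dslope p x F - f p) * area p x.
  by rewrite /dslope mulrBl divfK // mulf_neq0.
by rewrite normrM ler_wpM2r // ltW.
Qed.

(** The open quadrants at [p] are covered by the four sided estimates. On the two axis-parallel
    lines through [p], both [ddiff p x F] and [area p x] vanish. *)
Lemma double_primitive_dderiv_within a b f F :
  double_primitive a b f F -> dderiv_within a b F f.
Proof.
move=> primF p abp e e0.
have [d1 d10 h1] := dderiv_within_quadrant Plus Plus primF abp e0.
have [d2 d20 h2] := dderiv_within_quadrant Plus Minus primF abp e0.
have [d3 d30 h3] := dderiv_within_quadrant Minus Plus primF abp e0.
have [d4 d40 h4] := dderiv_within_quadrant Minus Minus primF abp e0.
exists (Num.min (Num.min d1 d2) (Num.min d3 d4)) => [|x abx].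
  by rewrite !lt_min d10 d20 d30.
rewrite !lt_min => /andP[/andP[x1 x2] /andP[x3 x4]].
move=> /andP[/andP[y1 y2] /andP[y3 y4]].
have [xp|xp|xp] := ltgtP (x.1 - p.1) 0; last first.
- have -> : ddiff p x F = 0 by rewrite /ddiff (subr0_eq xp); ring.
  by rewrite /area xp !(mul0r, mulr0, subrr, normr0).
- have [yp|yp|yp] := ltgtP (x.2 - p.2) 0; [exact: h2|exact: h1|].
  have -> : ddiff p x F = 0 by rewrite /ddiff (subr0_eq yp); ring.
  by rewrite /area yp !(mul0r, mulr0, subrr, normr0).
- have [yp|yp|yp] := ltgtP (x.2 - p.2) 0; [exact: h4|exact: h3|].
  have -> : ddiff p x F = 0 by rewrite /ddiff (subr0_eq yp); ring.
  by rewrite /area yp !(mul0r, mulr0, subrr, normr0).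
Qed.

(** Passing to [-F] turns the upper bound [ddiff_le_sup_slope] into the lower bound
    [inf_slope_le_ddiff]. *)
Definition dopp F : double_function R := DoubleFunction (ddom F) (fun x => - F x).

Lemma ddiff_dopp u v F : ddiff u v (dopp F) = - ddiff u v F.
Proof. by rewrite /ddiff /=; ring. Qed.

Lemma dderiv_within_dopp a b F h :
  dderiv_within a b F h -> dderiv_within a b (dopp F) (fun x => - h x).
Proof.
move=> dF p abp e e0; have [d d0 hd] := dF p abp e e0; exists d => // x abx x1 x2.
by rewrite ddiff_dopp mulNr -opprD normrN; exact: hd.
Qed.

Lemma rectW a b u v : rect a b u -> rect a b v -> rect u v `<=` rect a b.
Proof.
move=> [[? ?] _] [_ [? ?]] x [[? ?] [? ?]].
by split; split; [apply: le_trans|apply: le_trans|apply: le_trans|apply: le_trans]; eassumption.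
Qed.

Lemma dderiv_withinW a b u v F h : rect a b u -> rect a b v ->
  dderiv_within a b F h -> dderiv_within u v F h.
Proof.
move=> abu abv dF p uvp e e0; have uvab := rectW abu abv.
by have [d d0 hd] := dF p (uvab _ uvp) e e0; exists d => // x /uvab; exact: hd.
Qed.

(** The point [p] cuts the rectangle into four pieces, possibly degenerate. The alternating sum of
    [ddiff p x F] over the corners [x] is [ddiff u v F], the same holds for [area], and the absolute
    areas of the pieces add up to [area u v], so the four errors add up to the stated one. *)
Lemma dderiv_within_straddle a b F h p (e : R) :
  dderiv_within a b F h -> rect a b p -> 0 < e ->
  exists2 d : R, 0 < d & forall u v, rect a b u -> rect a b v -> rect u v p ->
    v.1 - u.1 < d -> v.2 - u.2 < d ->
    `|ddiff u v F - h p * area u v| <= e * area u v.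
Proof.
move=> dF abp e0; have [d d0 hd] := dF p abp e e0; exists d => //.
move=> [u1 u2] [v1 v2] [[/= au1 au2] [/= ub1 ub2]] [[/= av1 av2] [/= vb1 vb2]].
move=> [[/= up1 up2] [/= pv1 pv2]] uv1 uv2.
have cp1 : `|u1 - p.1| < d /\ `|v1 - p.1| < d.
  by split; rewrite ltr_norml; apply/andP; split; lra.
have cp2 : `|u2 - p.2| < d /\ `|v2 - p.2| < d.
  by split; rewrite ltr_norml; apply/andP; split; lra.
have q1 := hd (v1, v2) (conj (conj av1 av2) (conj vb1 vb2)) cp1.2 cp2.2.
have q2 := hd (u1, v2) (conj (conj au1 av2) (conj ub1 vb2)) cp1.1 cp2.2.
have q3 := hd (v1, u2) (conj (conj av1 au2) (conj vb1 ub2)) cp1.2 cp2.1.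
have q4 := hd (u1, u2) (conj (conj au1 au2) (conj ub1 ub2)) cp1.1 cp2.1.
move: q1 q2 q3 q4; rewrite /area /=.
rewrite !normrM (ler0_norm (_ : u1 - p.1 <= 0)); last by lra.
rewrite (ler0_norm (_ : u2 - p.2 <= 0)); last by lra.
rewrite (ger0_norm (_ : 0 <= v1 - p.1)); last by lra.
rewrite (ger0_norm (_ : 0 <= v2 - p.2)); last by lra.
rewrite !ler_norml /ddiff /= => /andP[? ?] /andP[? ?] /andP[? ?] /andP[? ?].
by apply/andP; split; lra.
Qed.

(** * Bounding the mean slope by repeated quartering *)

Definition rect_half (q q' : (R * R) * (R * R)) : Prop :=
  [/\ rect q.1 q.2 q'.1, rect q.1 q.2 q'.2,
      q'.2.1 - q'.1.1 = (q.2.1 - q.1.1) / 2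
    & q'.2.2 - q'.1.2 = (q.2.2 - q.1.2) / 2].

(** Double difference and area are both additive over the four quarters, so the inequality cannot
    fail on all of them: if it fails on three, it holds on the fourth. *)
Lemma exists_rect_half F (c : R) q :
  pt_lt q.1 q.2 -> c * area q.1 q.2 <= ddiff q.1 q.2 F ->
  exists q', [/\ rect_half q q', pt_lt q'.1 q'.2
    & c * area q'.1 q'.2 <= ddiff q'.1 q'.2 F].
Proof.
case: q => [[u1 u2] [v1 v2]] [/= uv1 uv2] cF.
pose w1 := (u1 + v1) / 2; pose w2 := (u2 + v2) / 2.
have w1E : w1 = (u1 + v1) / 2 by [].
have w2E : w2 = (u2 + v2) / 2 by [].
have half (x1 x2 y1 y2 : R) : u1 <= x1 -> u2 <= x2 -> y1 <= v1 -> y2 <= v2 ->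
    y1 - x1 = (v1 - u1) / 2 -> y2 - x2 = (v2 - u2) / 2 ->
    rect_half ((u1, u2), (v1, v2)) ((x1, x2), (y1, y2)) /\
    pt_lt (x1, x2) (y1, y2).
  by move=> *; split; split=> //=; try (split; split=> /=); lra.
have [h1|h1] := leP (c * area (u1, u2) (w1, w2)) (ddiff (u1, u2) (w1, w2) F).
  by exists ((u1, u2), (w1, w2)); have [||||||? ?] := half u1 u2 w1 w2; try lra.
have [h2|h2] := leP (c * area (w1, u2) (v1, w2)) (ddiff (w1, u2) (v1, w2) F).
  by exists ((w1, u2), (v1, w2)); have [||||||? ?] := half w1 u2 v1 w2; try lra.
have [h3|h3] := leP (c * area (u1, w2) (w1, v2)) (ddiff (u1, w2) (w1, v2) F).
  by exists ((u1, w2), (w1, v2)); have [||||||? ?] := half u1 w2 w1 v2; try lra.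
exists ((w1, w2), (v1, v2)); have [||||||hq lt_q] := half w1 w2 v1 v2; try lra.
split=> // {hq lt_q half}; move: cF h1 h2 h3; rewrite /area /ddiff /=.
by move: w1 w2 {w1E w2E} => w1 w2; lra.
Qed.

Lemma nested_intervals (u v : nat -> R) :
  (forall n, u n <= u n.+1) -> (forall n, v n.+1 <= v n) ->
  (forall n, u n <= v n) -> exists p : R, forall n, u n <= p /\ p <= v n.
Proof.
move=> uS vS uv; exists (sup (range u)).
have umono : {homo u : m n / (m <= n)%N >-> m <= n} by apply/nondecreasing_seqP.
have vmono : {homo v : m n / (m <= n)%N >-> n <= m} by apply/nonincreasing_seqP.
have uvb n : ubound (range u) (v n).
  move=> _ [m _ <-]; apply: le_trans (umono _ _ (leq_maxl m n)) _.
  exact: le_trans (uv _) (vmono _ _ (leq_maxr m n)).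
split; last by apply: ge_sup => //; exists (u 0%N), 0%N.
by apply: ub_le_sup; [exists (v 0%N)|exists n].
Qed.

Lemma halving_lt (l : nat -> R) (d : R) : (forall n, l n.+1 = l n / 2) ->
  0 < l 0%N -> 0 < d -> exists N, forall n, (N <= n)%N -> l n < d.
Proof.
(* This [N] exceeds [l 0 / d], and [N <= n < 2 ^ n]. *)
move=> lS l0 d0; exists (Num.truncn (l 0%N / d)).+1 => n Nn.
have lE m : l m = l 0%N / 2 ^+ m.
  by elim: m => [|m IH]; rewrite ?divr1 // lS IH exprS; field; rewrite expf_neq0.
rewrite lE ltr_pdivrMr ?exprn_gt0 // mulrC -ltr_pdivrMr //.
apply: lt_le_trans (truncnS_gt _) _; rewrite -natrX ler_nat.
exact: leq_trans Nn (ltnW (ltn_expl _ _)).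
Qed.

(** The successive quarters keep mean slope at least [c] and shrink to a common point, where [h]
    bounds their slopes in the limit by the straddle estimate. *)
Lemma ddiff_le_sup_slope a b F h :
  pt_lt a b -> dderiv_within a b F h ->
  exists2 p, rect a b p & ddiff a b F <= h p * area a b.
Proof.
move=> ab dF; have area0 u v : pt_lt u v -> 0 < area u v.
  by move=> [? ?]; rewrite mulr_gt0 // subr_gt0.
pose c := ddiff a b F / area a b.
pose P (q : (R * R) * (R * R)) :=
  pt_lt q.1 q.2 /\ c * area q.1 q.2 <= ddiff q.1 q.2 F.
have [g Pg] : {g & forall q, P q -> rect_half q (g q) /\ P (g q)}.
  (* The choice function must be total, so a rectangle violating [P] is sent to itself. *)
  apply: (@choice _ _ (fun q q1 => P q -> rect_half q q1 /\ P q1)) => q.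
  have [[q12 qc]|nPq] := pselect (P q); last by exists q.
  by have [q' [? ? ?]] := exists_rect_half q12 qc; exists q'.
pose q n := iter n g (a, b).
have Pq n : P (q n).
  elim: n => [|n IH]; last by have [] := Pg _ IH.
  by split=> //=; rewrite /c divfK // gt_eqF // area0.
have hq n : rect_half (q n) (q n.+1) by have [] := Pg _ (Pq n).
have [p1 hp1] : exists p1 : R, forall n, (q n).1.1 <= p1 /\ p1 <= (q n).2.1.
  apply: nested_intervals => n; [by case: (hq n) => -[[]]| |].
    by case: (hq n) => _ [_ []].
  by case: (Pq n) => -[/ltW].
have [p2 hp2] : exists p2 : R, forall n, (q n).1.2 <= p2 /\ p2 <= (q n).2.2.
  apply: nested_intervals => n; [by case: (hq n) => -[[]]| |].
    by case: (hq n) => _ [_ []].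
  by case: (Pq n) => -[_ /ltW].
have abq n : rect a b (q n).1 /\ rect a b (q n).2.
  elim: n => [|n [IH1 IH2]].
    by case: ab => /ltW ? /ltW ?; split; split; split => /=.
  by case: (hq n) => ? ? _ _; split; apply: (rectW IH1 IH2).
have qp n : rect (q n).1 (q n).2 (p1, p2).
  by have [? ?] := hp1 n; have [? ?] := hp2 n; split; split.
exists (p1, p2); first exact: (qp 0%N).
rewrite -ler_pdivrMr ?area0 // -/c leNgt; apply/negP => hc.
(* With half the gap as error, small quarters have slope at most the midpoint of [h (p1, p2)] and
   [c], which is below [c]. *)
have e0 : 0 < (c - h (p1, p2)) / 2 by lra.
have [d d0 hd] := dderiv_within_straddle dF (qp 0%N) e0.
have [ab1 ab2] := ab.
have [N1 hN1] : exists N, forall n, (N <= n)%N -> (q n).2.1 - (q n).1.1 < d.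
  by apply: halving_lt => //= [n|]; [case: (hq n)|rewrite subr_gt0].
have [N2 hN2] : exists N, forall n, (N <= n)%N -> (q n).2.2 - (q n).1.2 < d.
  by apply: halving_lt => //= [n|]; [case: (hq n)|rewrite subr_gt0].
pose n := maxn N1 N2.
have := hd _ _ (abq n).1 (abq n).2 (qp n) (hN1 _ (leq_maxl _ _)) (hN2 _ (leq_maxr _ _)).
rewrite ler_norml => /andP[_]; have [/area0 + cq] := Pq n.
move: cq; move: (area _ _) (ddiff _ _ _) => A D cq A0 DA.
by move: hc; rewrite ltNge => /negP; apply; rewrite -(ler_pM2r A0); lra.
Qed.

Lemma inf_slope_le_ddiff a b F h :
  pt_lt a b -> dderiv_within a b F h ->
  exists2 p, rect a b p & h p * area a b <= ddiff a b F.
Proof.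
move=> ab /dderiv_within_dopp /(ddiff_le_sup_slope ab) [p abp].
by rewrite ddiff_dopp mulNr lerN2; exists p.
Qed.

(** * Partitions and Riemann sums *)

Lemma exists_fine_partition (c d e : R) : c < d -> 0 < e ->
  exists2 s, itv_partition c d s &
    forall i, (i < size s)%N -> 0 < part_len c d s i < e.
Proof.
move=> cd e0; pose n := (Num.truncn ((d - c) / e)).+1.
have n0 : 0 < n%:R :> R by rewrite ltr0n.
(* Equal subdivision; the shift to [i.+1] is there because [s] omits the left endpoint [c]. *)
pose s := mkseq (fun i => c + (d - c) * i.+1%:R / n%:R) n.
have ptE i : (i <= n)%N -> part_pt c d s i = c + (d - c) * i%:R / n%:R.
  case: i => [|i] ni; first by rewrite /part_pt /= mulr0 mul0r addr0.
  by rewrite /part_pt /= nth_mkseq.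
have lenE i : (i < n)%N -> part_len c d s i = (d - c) / n%:R.
  move=> ni; rewrite /part_len !ptE // 1?ltnW // -natr1.
  by field; rewrite gt_eqF.
have len0 : 0 < (d - c) / n%:R by rewrite divr_gt0 ?subr_gt0.
have sn : size s = n by rewrite size_mkseq.
exists s; last first.
  move=> i; rewrite sn => ni; rewrite lenE // len0 /= ltr_pdivrMr //.
  by rewrite mulrC -ltr_pdivrMr // truncnS_gt.
split; last first.
  rewrite (last_nth d) sn -/(part_pt c d s n) ptE //; apply/eqP.
  by field; rewrite gt_eqF.
apply/(pathP d) => i; rewrite sn => ni.
by have := len0; rewrite -(lenE _ ni) subr_gt0.
Qed.

(** A double difference is a difference in one coordinate of differences in the other, so the double
    sum telescopes first in [j], then in [i]. *)
Lemma ddiff_partition a b F (s1 s2 : seq R) :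
  itv_partition a.1 b.1 s1 -> itv_partition a.2 b.2 s2 ->
  ddiff a b F = \sum_(i < size s1) \sum_(j < size s2)
    ddiff (part_pt a.1 b.1 s1 i, part_pt a.2 b.2 s2 j)
          (part_pt a.1 b.1 s1 i.+1, part_pt a.2 b.2 s2 j.+1) F.
Proof.
move=> /(itv_partition_nth_size b.1) end1 /(itv_partition_nth_size b.2) end2.
set x := part_pt a.1 b.1 s1; set y := part_pt a.2 b.2 s2.
pose k i j := F (x i, y j).
have inner i : \sum_(j < size s2) ddiff (x i, y j) (x i.+1, y j.+1) F =
    (k i.+1 (size s2) - k i.+1 0) - (k i (size s2) - k i 0).
  rewrite -(big_mkord xpredT (fun j => ddiff (x i, y j) (x i.+1, y j.+1) F)).
  rewrite (telescope_sumr_eq (fun j => k i.+1 j - k i j)) //; first by ring.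
  by move=> j _; rewrite /ddiff /= /k; ring.
under eq_bigr => i _ do rewrite inner.
rewrite -(big_mkord xpredT (fun i => (k i.+1 (size s2) - k i.+1 0) - (k i (size s2) - k i 0))).
rewrite (telescope_sumr_eq (fun i => k i (size s2) - k i 0)) //.
rewrite /k /x /y /part_pt end1 end2 /= /ddiff; ring.
Qed.

(** Since [F] is arbitrary, this also shows that the Newton integral does not depend on the
    primitive. *)
Lemma double_primitive_ddiff a b f F I :
  pt_lt a b -> is_double_Riemann_integral a b f I ->
  double_primitive a b f F -> ddiff a b F = I.
Proof.
move=> [ab1 ab2] intf /double_primitive_dderiv_within dF.
apply/eqP; rewrite -subr_eq0 -normr_le0; apply/ler_addgt0Pl => e e0; rewrite addr0.
have [d d0 hd] := intf e e0.
(* Cells with sides below [d / 2] have diagonal below [d]. *)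
have d20 : 0 < d / 2 by lra.
have [s1 part1 len1] := exists_fine_partition ab1 d20.
have [s2 part2 len2] := exists_fine_partition ab2 d20.
have diag i j : (i < size s1)%N -> (j < size s2)%N -> part_diag a b s1 s2 i j < d.
  move=> /len1 /andP[x0 xd] /len2 /andP[y0 yd].
  rewrite /part_diag -(ger0_norm (ltW d0)) -sqrtr_sqr ltr_sqrt ?exprn_gt0 //.
  by nra.
set x := part_pt a.1 b.1 s1; set y := part_pt a.2 b.2 s2.
have lt_cell i j : (i < size s1)%N -> (j < size s2)%N ->
    pt_lt (x i, y j) (x i.+1, y j.+1).
  by move=> /len1 /andP[+ _] /len2 /andP[+ _]; rewrite !subr_gt0.
have ab_cell i j : (i <= size s1)%N -> (j <= size s2)%N -> rect a b (x i, y j).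
  move=> i1 j2; split; split=> /=.
  - exact: (itv_partition_nth_ge i1 part1).
  - exact: (itv_partition_nth_ge j2 part2).
  - exact: (itv_partition_nth_le i1 part1).
  - exact: (itv_partition_nth_le j2 part2).
have d_cell i j : (i < size s1)%N -> (j < size s2)%N ->
    dderiv_within (x i, y j) (x i.+1, y j.+1) F f.
  by move=> i1 j2; apply: dderiv_withinW dF; apply: ab_cell => //; exact: ltnW.
(* Tags are chosen for all pairs of indices at once; outside the partition the value is the dummy
   [a]. *)
have tags (Q : nat -> nat -> R * R -> Prop) :
    (forall i j, (i < size s1)%N -> (j < size s2)%N ->
      exists2 p, part_cell a b s1 s2 i j p & Q i j p) ->
    exists xi, forall i j, (i < size s1)%N -> (j < size s2)%N ->
      part_cell a b s1 s2 i j (xi i j) /\ Q i j (xi i j).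
  move=> ex; have [|xi xiP] := @choice (nat * nat)%type (R * R)%type (fun ij p =>
      (ij.1 < size s1)%N -> (ij.2 < size s2)%N ->
      part_cell a b s1 s2 ij.1 ij.2 p /\ Q ij.1 ij.2 p).
    move=> [i j] /=; case: (ltnP i (size s1)) => [i1|_]; last by exists a.
    case: (ltnP j (size s2)) => [j2|_]; last by exists a.
    by have [p ? ?] := ex i j i1 j2; exists p.
  by exists (fun i j => xi (i, j)) => i j; exact: (xiP (i, j)).
have termE i j p : f p * area (x i, y j) (x i.+1, y j.+1) =
    f p * part_len a.1 b.1 s1 i * part_len a.2 b.2 s2 j by rewrite mulrA.
have [xi xiP] := tags _ (fun i j i1 j2 =>
  ddiff_le_sup_slope (lt_cell i j i1 j2) (d_cell i j i1 j2)).
have [eta etaP] := tags _ (fun i j i1 j2 =>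
  inf_slope_le_ddiff (lt_cell i j i1 j2) (d_cell i j i1 j2)).
have := hd s1 s2 xi part1 part2 diag (fun i j i1 j2 => (xiP i j i1 j2).1).
have := hd s1 s2 eta part1 part2 diag (fun i j i1 j2 => (etaP i j i1 j2).1).
have up : ddiff a b F <= Riemann_sum a b s1 s2 xi f.
  rewrite (ddiff_partition F part1 part2); apply: ler_sum => i _; apply: ler_sum => j _.
  by rewrite -termE; have [] := xiP i j (ltn_ord i) (ltn_ord j).
have low : Riemann_sum a b s1 s2 eta f <= ddiff a b F.
  rewrite (ddiff_partition F part1 part2); apply: ler_sum => i _; apply: ler_sum => j _.
  by rewrite -termE; have [] := etaP i j (ltn_ord i) (ltn_ord j).
(* The double difference lies between the two Riemann sums, both within [e] of [I]. *)
rewrite !ltr_norml ler_norml => /andP[? ?] /andP[? ?].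
by apply/andP; split; lra.
Qed.

End SecondFundamentalTheorem.

Theorem proposition37 (R : realType) (a b : R * R) (f : double_function R)
    (lt_ab : pt_lt a b) (dom_f : rect a b `<=` ddom f)
    (prim_f : exists F : double_function R, double_primitive a b f F)
    (I : R) (int_f : is_double_Riemann_integral a b f I) :
  is_double_Newton_integral a b f I.
Proof. by split=> // F; exact: double_primitive_ddiff. Qed.
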